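(* Let $(R,\mathfrak m)$ be a $1$-dimensional complete local ring. The following are equivalent: (i) $t(M)\oplus\overline M\cong M$ for every finitely generated $R$-module $M$, where $\overline M=M/t(M)$; (ii) $R$ is regular.
   Context: Rings are commutative and noetherian; complete means complete in the $\mathfrak m$-adic topology. $t(M)$ denotes the torsion submodule of $M$; for a $1$-dimensional (equidimensional) local ring the torsion submodule is identified with $H^0_{\mathfrak m}(M)=\{x\in M:\mathfrak m^n x=0\text{ for some }n\}$, and this is the meaning of $t(M)$ here. *)

(* Defs.v *)
From HB Require Import structures.
From mathcomp Require Import all_boot all_order all_algebra.
From mathcomp Require Import boolp.

Set Implicit Arguments.
Unset Strict Implicit.
Unset Printing Implicit Defensive.

Import GRing.Theory.
Local Open Scope ring_scope.
Local Open Scope quotient_scope.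

Section SubmodType.
Variables (R : pzRingType) (V : lmodType R) (N : submodClosed V).

Record submod_of := SubmodOf { submod_val : V; _ : submod_val \in N }.

HB.instance Definition _ := [isSub for submod_val].
HB.instance Definition _ := [Choice of submod_of by <:].
HB.instance Definition _ := [SubChoice_isSubLmodule of submod_of by <:].

End SubmodType.

Section QuotLmod.
Variables (R : pzRingType) (V : lmodType R) (N : submodClosed V).

(* [submodClosed] is stated for semimodules and does not provide closure
   under opposites, which [Quotient.quot] needs; this copy of [N] has it. *)
Definition zmod_pred : {pred V} := fun x => x \in N.

Lemma zmod_pred_closed : GRing.submod_closed zmod_pred.
Proof. by split=> [|a x y xN yN]; rewrite /zmod_pred ?rpred0 ?rpredD ?rpredZ. Qed.

HB.instance Definition _ :=
  GRing.isSubmodClosed.Build R V zmod_pred zmod_pred_closed.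

Local Notation quot := (Quotient.quot zmod_pred).

Definition quot_scale (a : R) : quot -> quot :=
  lift_op1 quot ( *:%R a).

Lemma pi_scale (a : R) : {morph \pi_quot : x / a *: x >-> quot_scale a x}.
Proof.
move=> x; rewrite /quot_scale; unlock; apply/eqP.
by rewrite -Quotient.idealrBE -scalerBr rpredZ // Quotient.idealrBE reprK.
Qed.

Lemma quot_scaleA (a b : R) (v : quot) :
  quot_scale a (quot_scale b v) = quot_scale (a * b) v.
Proof. by rewrite -[v]reprK -!pi_scale scalerA. Qed.

Lemma quot_scale1 : left_id 1 quot_scale.
Proof. by move=> v; rewrite -[v]reprK -pi_scale scale1r. Qed.

Lemma quot_scaleDr : right_distributive quot_scale +%R.
Proof.
move=> a u v; rewrite -[u]reprK -[v]reprK -!pi_scale -!raddfD /= -pi_scale.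
by rewrite scalerDr; reflexivity.
Qed.

Lemma quot_scaleDl (v : quot) :
  {morph quot_scale^~ v : a b / a + b}.
Proof. by move=> a b; rewrite -[v]reprK -!pi_scale -raddfD scalerDl; reflexivity. Qed.

HB.instance Definition _ := GRing.Zmodule_isLmodule.Build R quot
  quot_scaleA quot_scale1 quot_scaleDr quot_scaleDl.

Definition lmod_quot : lmodType R := quot.

End QuotLmod.

Definition span (R : pzRingType) (V : lmodType R) (S : {pred V}) : {pred V} :=
  fun v => `[< exists s : seq (R * V),
    {in s, forall p, p.2 \in S} /\ v = \sum_(p <- s) p.1 *: p.2 >].

Definition generates (R : pzRingType) (V : lmodType R) (s : seq V)
    (N : {pred V}) : Prop :=
  N =i span (mem s).

Definition finitely_generated (R : pzRingType) (M : lmodType R) : Prop :=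
  exists s : seq M, generates s predT.

(* Ideals of [R], the unit ideal included, are the submodules of [R^o];
   [idealr_closed] from [ring_quotient] describes the proper ones. *)
Definition noetherian (R : comNzRingType) : Prop :=
  forall I : {pred R^o}, GRing.submod_closed I ->
  exists s : seq R^o, generates s I.

Definition maximal_ideal (R : comNzRingType) (m : {pred R}) : Prop :=
  idealr_closed m /\
  forall J : {pred R}, idealr_closed J -> {subset m <= J} -> J =i m.

Definition local_ring (R : comNzRingType) (m : {pred R}) : Prop :=
  maximal_ideal m /\ forall n : {pred R}, maximal_ideal n -> n =i m.

Definition prime_ideal (R : comNzRingType) (P : {pred R}) : Prop :=
  idealr_closed P /\ prime_idealr_closed P.

Definition prime_chain (R : comNzRingType) (n : nat)
    (P : 'I_n.+1 -> {pred R}) : Prop :=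
  (forall i, prime_ideal (P i)) /\
  (forall i j : 'I_n.+1, (i < j)%N ->
     {subset P i <= P j} /\ ~ {subset P j <= P i}).

Definition krull_dim (R : comNzRingType) (d : nat) : Prop :=
  (exists P : 'I_d.+1 -> {pred R}, prime_chain P) /\
  (forall (n : nat) (P : 'I_n.+1 -> {pred R}), prime_chain P -> (n <= d)%N).

Definition embdim (R : comNzRingType) (m : {pred R}) (d : nat) : Prop :=
  (exists s : seq R^o, size s = d /\ generates s m) /\
  (forall s : seq R^o, generates s m -> (d <= size s)%N).

Definition regular_local (R : comNzRingType) (m : {pred R}) : Prop :=
  exists d : nat, krull_dim R d /\ embdim m d.

Definition ideal_pow (R : comNzRingType) (m : {pred R}) (n : nat) : {pred R^o} :=
  @span R R^o (fun x => `[< exists y : 'I_n -> R,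
    (forall i, y i \in m) /\ x = \prod_(i < n) y i >]).

Definition adic_cauchy (R : comNzRingType) (m : {pred R}) (u : nat -> R) : Prop :=
  forall n, exists K : nat, forall i j : nat, (K <= i)%N -> (K <= j)%N ->
    u i - u j \in ideal_pow m n.

Definition adic_lim (R : comNzRingType) (m : {pred R}) (u : nat -> R) (l : R) : Prop :=
  forall n, exists K : nat, forall i : nat, (K <= i)%N ->
    u i - l \in ideal_pow m n.

(* Completeness includes separatedness, whence the uniqueness of limits. *)
Definition adic_complete (R : comNzRingType) (m : {pred R}) : Prop :=
  forall u : nat -> R, adic_cauchy m u -> exists! l : R, adic_lim m u l.

Section Torsion.
Variables (R : comNzRingType) (m : {pred R}) (M : lmodType R).

(* The local cohomology [H^0_m(M)], which for a 1-dimensional local ring is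
   taken as the meaning of the torsion submodule. *)
Definition torsion : {pred M} :=
  fun x => `[< exists n : nat, {in ideal_pow m n, forall a, a *: x = 0} >].

Lemma ideal_powS n a : a \in ideal_pow m n.+1 -> a \in ideal_pow m n.
Proof.
move=> /asboolP[s [sP ->]]; apply/asboolP.
elim: s sP => [|[c b] s IHs] sP.
  by exists [::]; split=> //; rewrite !big_nil.
have [|t [tP Et]] := IHs.
  by move=> p ps; apply: sP; rewrite inE ps orbT.
have /asboolP[y [ym /= Eb]] := sP (c, b) (mem_head _ _).
exists ((c * y ord0, \prod_(i < n) y (lift ord0 i)) :: t); split=> [p|].
  rewrite inE => /orP[/eqP->/=|/tP//].
  by apply/asboolP; exists (fun i => y (lift ord0 i)).
rewrite !big_cons Et /= Eb big_ord_recl; congr (_ + _).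
by rewrite -scalerA.
Qed.

Lemma ideal_pow_le n k a :
  (n <= k)%N -> a \in ideal_pow m k -> a \in ideal_pow m n.
Proof.
move=> /subnK <-; elim: (k - n)%N => [//|j IHj].
by rewrite addSn => /ideal_powS.
Qed.

Lemma torsion_submod_closed : GRing.submod_closed torsion.
Proof.
split=> [|c x y /asboolP[n xn] /asboolP[k yk]]; apply/asboolP.
  by exists 0 => a _; rewrite scaler0.
exists (maxn n k) => a ak; rewrite scalerDr scalerA mulrC -scalerA.
rewrite xn ?yk ?scaler0 ?addr0 //.
  exact: ideal_pow_le (leq_maxr _ _) ak.
exact: ideal_pow_le (leq_maxl _ _) ak.
Qed.

HB.instance Definition _ :=
  GRing.isSubmodClosed.Build R M torsion torsion_submod_closed.

Definition torsion_part : lmodType R := submod_of (torsion : submodClosed M).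
Definition torsion_quot : lmodType R := lmod_quot (torsion : submodClosed M).

End Torsion.

Definition lmod_isomorphic (R : pzRingType) (U V : lmodType R) : Prop :=
  exists f : {linear U -> V}, bijective f.

(* Main.v *)
(* If every M splits, the number of generators is additive along
   0 -> t(M) -> M -> M/t(M) -> 0, so t(M) = 0 as soon as M/t(M) needs as many
   generators as M. For M = R this gives t(R) = 0, hence ideals are torsion-free.
   Given a relation z between minimal generators x_1, ..., x_n of m, the module
   R^n / m z has the torsion element z, while its torsion-free quotient still
   surjects onto m; so z = 0. The Koszul relation between two generators then
   forces n = 1, and n = 0 is excluded by the dimension. Conversely, if m = (t)
   then minimal generators of the t-torsion-free module M/t(M) form a basis, and
   M -> M/t(M) splits. *)
Require Import Defs.
From HB Require Import structures.
From mathcomp Require Import all_boot all_order all_algebra.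
From mathcomp Require Import boolp ring.

Set Implicit Arguments.
Unset Strict Implicit.
Unset Printing Implicit Defensive.

Import GRing.Theory.
Local Open Scope ring_scope.
Local Open Scope quotient_scope.

(** * Least witnesses, quotient maps and finite spanning families *)

Lemma ex_least (P : nat -> Prop) :
  (exists n, P n) -> exists n, P n /\ forall k, P k -> (n <= k)%N.
Proof.
move=> [n0 Pn0]; have ex : exists n, `[< P n >] by exists n0; apply/asboolP.
case: (ex_minnP ex) => n /asboolP Pn min; exists n; split=> // k Pk.
by apply: min; apply/asboolP.
Qed.

Lemma lmod_quot_proj (R : pzRingType) (V : lmodType R) (N : submodClosed V) :
  exists p : {linear V -> lmod_quot N},
    (forall w, exists v, p v = w) /\ (forall v, p v = 0 <-> v \in N).
Proof.
pose p (v : V) : lmod_quot N := \pi_(Quotient.quot (zmod_pred N)) v.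
have p_lin : linear p.
  by move=> a u v; rewrite /p raddfD /= pi_scale.
pose pL : {linear V -> lmod_quot N} :=
  HB.pack p (GRing.isLinear.Build R V (lmod_quot N) *:%R p p_lin).
exists pL; split=> [w|v]; first by exists (repr w); exact: reprK.
rewrite -(linear0 pL); split=> [/eqP|vN].
  by rewrite -Quotient.idealrBE subr0.
by apply/eqP; rewrite -Quotient.idealrBE subr0.
Qed.

Section Spanning.
Variables (R : pzRingType) (V : lmodType R).

(** Only one inclusion is required: the [x i] may lie outside [N]. Indexing by ['I_n] makes the
    number of generators explicit and lets one be dropped. *)
Definition spans n (x : 'I_n -> V) (N : {pred V}) : Prop :=
  forall v, v \in N -> exists c : 'I_n -> R, v = \sum_i c i *: x i.

(** The relation can be solved for [x j], because its coefficient there is invertible; substituting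
    eliminates [x j] everywhere. *)
Lemma spans_drop n (x : 'I_n -> V) (N : {pred V}) c j b :
  spans x N -> \sum_i c i *: x i = 0 -> b * c j = 1 ->
  spans (fun i : 'I_n.-1 => x (lift j i)) N.
Proof.
move=> xN; rewrite (bigD1_ord j) //= => /eqP; rewrite addr_eq0 => /eqP cx bc v.
move=> /xN[d ->].
exists (fun i => d (lift j i) - d j * b * c (lift j i)).
rewrite (bigD1_ord j) //= -[x j]scale1r -bc -scalerA cx !scalerN scalerA.
rewrite scaler_sumr -sumrN -big_split /=; apply: eq_bigr => i _.
by rewrite scalerA scalerBl addrC.
Qed.

Lemma spans_trans n k (x : 'I_n -> V) (y : 'I_k -> V) (N : {pred V}) :
  spans x N -> (forall i, exists c : 'I_k -> R, x i = \sum_j c j *: y j) ->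
  spans y N.
Proof.
move=> xN /choice[e Ex] v /xN[c ->].
exists (fun j => \sum_i c i * e i j).
transitivity (\sum_i \sum_j c i *: (e i j *: y j)).
  by apply: eq_bigr => i _; rewrite Ex scaler_sumr.
rewrite exchange_big; apply: eq_bigr => j _ /=.
by rewrite scaler_suml; apply: eq_bigr => i _; rewrite scalerA.
Qed.

(** A list of scaled generators, possibly with repetitions, collapses to one coefficient per
    position of [s]. *)
Lemma generates_spans (s : seq V) (N : {pred V}) :
  generates s N -> {subset s <= N} /\ spans (tnth (in_tuple s)) N.
Proof.
move=> sN; split=> [x xs|v].
  rewrite sN; apply/asboolP; exists [:: (1, x)]; split=> [p|].
    by rewrite inE => /eqP->.
  by rewrite big_seq1 scale1r.
rewrite sN => /asboolP[t [ts ->]]; elim: t ts => [|[a y] t IHt] ts.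
  by exists (fun=> 0); rewrite big_nil big1 // => i _; rewrite scale0r.
have [|c Ec] := IHt; first by move=> p pt; apply: ts; rewrite inE pt orbT.
have /(@tnthP _ _ (in_tuple s))[j /= Ej] := ts (a, y) (mem_head _ _).
exists (fun i => (if i == j then a else 0) + c i).
rewrite big_cons Ec /= (eq_bigr _ (fun i _ => scalerDl _ _ _)) big_split /=.
congr (_ + _); rewrite (bigD1 j) //= eqxx -Ej big1 ?addr0 // => i /negPf->.
by rewrite scale0r.
Qed.

Lemma spans_generates n (x : 'I_n -> V) (N : {pred V}) :
  GRing.submod_closed N -> (forall i, x i \in N) -> spans x N ->
  exists s, size s = n /\ generates s N.
Proof.
move=> [N0 Nlin] xN xs; exists (codom x).
rewrite size_codom card_ord; split=> // v; apply/idP/idP => [/xs[c ->]|].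
  apply/asboolP; exists [seq (c i, x i) | i <- enum 'I_n]; split.
    by move=> _ /mapP[i _ ->] /=; apply: codom_f.
  by rewrite big_map big_enum.
move=> /asboolP[t [ts ->]]; elim: t ts => [|[a y] t IHt] ts.
  by rewrite big_nil.
rewrite big_cons /=; apply: Nlin.
  by have /codomP[i /= ->] := ts (a, y) (mem_head _ _).
by apply: IHt => p pt; apply: ts; rewrite inE pt orbT.
Qed.

End Spanning.

(** * Nakayama's lemma over a local ring *)

Section LocalRing.
Variables (R : comNzRingType) (m : {pred R}).
Hypothesis mI : idealr_closed m.
Hypothesis unit_notin : forall a, a \notin m -> exists b, b * a = 1.

Lemma ideal0 : 0 \in m. Proof. by case: mI. Qed.

Lemma idealMD a u v : u \in m -> v \in m -> a * u + v \in m.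
Proof. by case: mI => _ _; apply. Qed.

Lemma idealM a u : u \in m -> a * u \in m.
Proof. by move=> um; rewrite -[_ * _]addr0 idealMD // ideal0. Qed.

Lemma idealD u v : u \in m -> v \in m -> u + v \in m.
Proof. by move=> um vm; rewrite -[u]mul1r idealMD. Qed.

Lemma unit_1sub a : a \in m -> exists b, b * (1 - a) = 1.
Proof.
move=> am; apply: unit_notin; apply/negP => am'.
by case: mI => _ /negP + _; apply; rewrite -(subrK a 1) idealD.
Qed.

(** Nakayama's lemma, by induction on the number of generators: [T = m T] makes one of them
    redundant. *)
Lemma spans_nakayama (T : lmodType R) n (x : 'I_n -> T) :
  spans x predT ->
  (forall t : T, exists k (a : 'I_k -> R) (y : 'I_k -> T),
    (forall i, a i \in m) /\ t = \sum_i a i *: y i) ->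
  forall t : T, t = 0.
Proof.
move=> xT mT; elim: n x xT => [|n IHn] x xT t.
  by have [c ->] := xT t isT; rewrite big_ord0.
have [k [a [y [am Ex]]]] := mT (x ord0).
have [/= e Ey] := choice (fun i : 'I_k => xT (y i) isT).
pose d j := \sum_i a i * e i j.
have dm j : d j \in m.
  rewrite /d; elim/big_ind: _ => [|u v|i _]; first exact: ideal0.
    exact: idealD.
  by rewrite mulrC idealM.
have [b Eb] := unit_1sub (dm ord0).
(* Rewriting [x ord0] as the combination with coefficients [d j] in [m] gives a relation whose
   coefficient at [ord0] is the unit [1 - d ord0]. *)
have rel : \sum_j ((if j == ord0 then 1 else 0) - d j) *: x j = 0.
  rewrite (eq_bigr _ (fun i _ => scalerBl _ _ _)) sumrB.
  rewrite (bigD1 ord0) //= scale1r big1 => [|i /negPf->]; last first.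
    by rewrite scale0r.
  rewrite addr0 Ex; apply/eqP; rewrite subr_eq0; apply/eqP.
  transitivity (\sum_i \sum_j a i *: (e i j *: x j)).
    by apply: eq_bigr => i _; rewrite Ey scaler_sumr.
  rewrite exchange_big; apply: eq_bigr => j _ /=.
  by rewrite scaler_suml; apply: eq_bigr => i _; rewrite scalerA.
by apply: (IHn _ (spans_drop xT rel (b := b) (j := ord0) _)); rewrite eqxx.
Qed.

(* The second components already form a minimal spanning family of [N], so a
   combination of them that vanishes has all its coefficients in [m]; hence
   [T = m T]. *)
Lemma spans_prod_trivial (T N : lmodType R) n (x : 'I_n -> (T * N)%type) :
  spans x predT ->
  (forall k (y : 'I_k -> N), spans y predT -> (n <= k)%N) ->
  forall t : T, t = 0.
Proof.
move=> xTN min.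
have sum1 c : (\sum_i c i *: x i).1 = \sum_i c i *: (x i).1.
  by elim/big_rec2: _ => // i u v _ <-.
have sum2 c : (\sum_i c i *: x i).2 = \sum_i c i *: (x i).2.
  by elim/big_rec2: _ => // i u v _ <-.
have x1 : spans (fun i => (x i).1) predT.
  by move=> t _; have [c Ec] := xTN (t, 0) isT; exists c; rewrite -sum1 -Ec.
have x2 : spans (fun i => (x i).2) predT.
  by move=> t _; have [c Ec] := xTN (0, t) isT; exists c; rewrite -sum2 -Ec.
apply: (spans_nakayama x1) => t.
have [c Ec] := xTN (t, 0) isT.
exists n, c, (fun i => (x i).1); split=> [j|]; last by rewrite -sum1 -Ec.
apply: contraT => /unit_notin[b Eb].
have rel : \sum_i c i *: (x i).2 = 0 by rewrite -sum2 -Ec.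
(* Minimality gives [n <= n.-1], absurd since the index [j] forces [0 < n]. *)
have := min _ _ (spans_drop x2 rel Eb).
by rewrite leqNgt ltn_predL (leq_ltn_trans _ (ltn_ord j)).
Qed.

End LocalRing.


(** * Powers of an ideal and adic completeness *)

Lemma span_submod_closed (R : pzRingType) (V : lmodType R) (S : {pred V}) :
  GRing.submod_closed (Defs.span S).
Proof.
split=> [|a _ _ /asboolP[s [sS ->]] /asboolP[t [tS ->]]]; apply/asboolP.
  by exists [::]; rewrite big_nil.
exists ([seq (a * p.1, p.2) | p <- s] ++ t); split=> [p|].
  by rewrite mem_cat => /orP[/mapP[q qs ->]|/tS//]; exact: sS qs.
rewrite big_cat big_map scaler_sumr /=; congr (_ + _).
by apply: eq_bigr => p _; rewrite scalerA.
Qed.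

Section IdealPow.
Variables (R : comNzRingType) (m : {pred R}).

HB.instance Definition _ n :=
  GRing.isSubmodClosed.Build R R^o (ideal_pow m n) (span_submod_closed _).

Lemma ideal_powM n a x : x \in ideal_pow m n -> a * x \in ideal_pow m n.
Proof. exact: (@rpredZ R R^o (ideal_pow m n) a x). Qed.

Lemma expr_ideal_pow n x : x \in m -> x ^+ n \in ideal_pow m n.
Proof.
move=> xm; apply/asboolP; exists [:: (1, x ^+ n)]; split=> [p|].
  rewrite inE => /eqP-> /=; apply/asboolP; exists (fun=> x).
  by rewrite prodr_const card_ord.
by rewrite big_seq1 scale1r.
Qed.

Lemma ideal_pow1 a : idealr_closed m -> a \in ideal_pow m 1 -> a \in m.
Proof.
move=> mI /asboolP[s [sP ->]]; elim: s sP => [|[c b] s IHs] sP.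
  by rewrite big_nil ideal0.
rewrite big_cons idealMD //.
  have /asboolP[y [ym /= ->]] := sP (c, b) (mem_head _ _).
  by rewrite big_ord1.
by apply: IHs => p ps; apply: sP; rewrite inE ps orbT.
Qed.

Lemma ideal_pow_principal x n a : (forall v, v \in m -> exists c, v = c * x) ->
  a \in ideal_pow m n -> exists c, a = c * x ^+ n.
Proof.
move=> mx /asboolP[s [sP ->]]; elim: s sP => [|[c b] s IHs] sP.
  by exists 0; rewrite big_nil mul0r.
have [|d Ed] := IHs; first by move=> p ps; apply: sP; rewrite inE ps orbT.
have /asboolP[y [ym /= ->]] := sP (c, b) (mem_head _ _).
have [e Ee] := choice (fun i => mx (y i) (ym i)).
exists (c * (\prod_i e i) + d); rewrite big_cons Ed /=.
rewrite (eq_bigr _ (fun i _ => Ee i)).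
by rewrite big_split /= prodr_const card_ord mulrDl -mulrA.
Qed.

(** Both [0] and [a] are limits of the zero sequence. *)
Lemma adic_separated a :
  adic_complete m -> (forall n, a \in ideal_pow m n) -> a = 0.
Proof.
move=> mC am; have [|l [_ l_uniq]] := mC (fun=> 0).
  by move=> n; exists 0%N => *; rewrite subrr rpred0.
have <- : l = a.
  by apply: l_uniq => n; exists 0%N => *; rewrite sub0r rpredN; exact: am.
by apply: l_uniq => n; exists 0%N => *; rewrite subrr rpred0.
Qed.

(** The inverse is the limit of the geometric series [u]. *)
Lemma adic_complete_unit a :
  adic_complete m -> a \in m -> exists b, b * (1 - a) = 1.
Proof.
move=> mC am; pose u n := \sum_(i < n) a ^+ i.
have u_tail n d : u (n + d)%N - u n \in ideal_pow m n.
  elim: d => [|d IHd]; first by rewrite addn0 subrr rpred0.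
  rewrite addnS {1}/u big_ord_recr /= addrAC rpredD //.
  by apply: (@ideal_pow_le _ _ _ (n + d)); rewrite ?leq_addr ?expr_ideal_pow.
have [|l [ul _]] := mC u.
  move=> n; exists n => i j /subnKC <- /subnKC <-.
  rewrite -(subrKA (u n)); apply: rpredD; first exact: u_tail.
  by rewrite rpredBC; exact: u_tail.
exists l; apply/eqP; rewrite -subr_eq0; apply/eqP; apply: adic_separated => // n.
have [K uK] := ul n.
(* The index [K + n] is large enough both for [u] to be close to [l] and for the remaining power of
   [a] to lie in the [n]-th power of [m]. *)
have -> : l * (1 - a) - 1 = - ((1 - a) * (u (K + n)%N - l)) - a ^+ (K + n).
  by rewrite -[a ^+ _](subrK 1) subrX1 -/(u _); ring.
rewrite rpredB ?rpredN //; first by apply: rpredZ; rewrite uK // leq_addr.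
by apply: (@ideal_pow_le _ _ _ (K + n)); rewrite ?leq_addl ?expr_ideal_pow.
Qed.

End IdealPow.

(** * Units and nilpotents at the maximal ideal *)

(** By maximality the ideal [J = m + (a)] contains [1], so a multiple of [a] has the form [1 - u]
    with [u] in [m]. *)
Lemma maximal_unit (R : comNzRingType) (m : {pred R}) :
  maximal_ideal m -> (forall a, a \in m -> exists b, b * (1 - a) = 1) ->
  forall a, a \notin m -> exists b, b * a = 1.
Proof.
move=> [mI mM] unit1 a am.
pose J : {pred R} := fun x => `[< exists u r, u \in m /\ x = u + r * a >].
have [/asboolP[u [r [um E]]]|J1] := boolP (1 \in J).
  have [b Eb] := unit1 u um; exists (b * r).
  by rewrite -mulrA -Eb E [u + _]addrC addrK.
suff Jm : J =i m.
  case/negP: am; rewrite -Jm; apply/asboolP; exists 0, 1.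
  by rewrite (ideal0 mI) add0r mul1r.
apply: mM => [|x xm]; last first.
  by apply/asboolP; exists x, 0; rewrite mul0r addr0.
split=> // [|c _ _ /asboolP[u [r [um ->]]] /asboolP[v [s [vm ->]]]].
  by apply/asboolP; exists 0, 0; rewrite (ideal0 mI) add0r mul0r.
apply/asboolP; exists (c * u + v), (c * r + s); rewrite (idealMD mI) //.
by rewrite mulrDr mulrDl mulrA addrACA.
Qed.

(** If [m] were nil, every prime would contain it and hence equal it, leaving no strict chain of two
    primes. *)
Lemma krull_dim1_not_nil (R : comNzRingType) (m : {pred R}) :
  maximal_ideal m -> krull_dim R 1 ->
  ~ (forall x, x \in m -> exists n, x ^+ n = 0).
Proof.
move=> [mI mM] [[P [Pp Pc]] _] nil.
have Pm i : m =i P i.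
  have [[P0 P1 Plin] Pprime] := Pp i.
  move=> x; rewrite mM // => {}x /nil[n].
  have : 0 \in P i by [].
  move=> + En; rewrite -En; elim: n {En} => [|n IHn]; first by rewrite (negPf P1).
  by rewrite exprS => /Pprime/orP[].
have [_ []] := Pc ord0 ord_max isT.
by move=> x; rewrite -!Pm.
Qed.

(** * From splitting to regularity *)

(** The isomorphism carries the generators of [M] to generators of the direct sum, where
    [spans_prod_trivial] applies. *)
Lemma torsion_eq0 (R : comNzRingType) (m : {pred R}) (M : lmodType R) n
    (x : 'I_n -> M) :
  idealr_closed m -> (forall a, a \notin m -> exists b, b * a = 1) ->
  lmod_isomorphic (torsion_part m M * torsion_quot m M)%type M ->
  spans x predT ->
  (forall k (y : 'I_k -> torsion_quot m M), spans y predT -> (n <= k)%N) ->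
  forall v, v \in @torsion R m M -> v = 0.
Proof.
move=> mI unit_notin [f [g fK gK]] xM min v vt.
have := @spans_prod_trivial _ _ mI unit_notin _ _ _ (fun i => g (x i)) _ min.
move=> T0; have /(congr1 val) : Sub v vt = 0 :> torsion_part m M.
  apply: T0 => w _; have [c Ec] := xM (f w) isT.
  exists c; apply: (can_inj fK); rewrite Ec linear_sum.
  by apply: eq_bigr => i _; rewrite linearZ gK.
by rewrite SubK raddf0.
Qed.

Lemma linear_sumZ (R : pzRingType) (U V : lmodType R) (f : {linear U -> V}) n
    (c : 'I_n -> R) (x : 'I_n -> U) :
  f (\sum_i c i *: x i) = \sum_i c i *: f (x i).
Proof. by rewrite linear_sum; apply: eq_bigr => i _; rewrite linearZ. Qed.

(* With [z] a relation between the [x i], the module [R^n / m z] has the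
   torsion element [z], while its torsion-free quotient still surjects onto the
   span of the [x i] and so needs [n] generators. *)
Lemma min_spans_free (R : comNzRingType) (m : {pred R}) (W : lmodType R) n
    (x : 'I_n -> W) :
  idealr_closed m -> (forall a, a \notin m -> exists b, b * a = 1) ->
  (forall M : lmodType R, finitely_generated M ->
      lmod_isomorphic (torsion_part m M * torsion_quot m M)%type M) ->
  (forall w : W, w \in torsion m (M := W) -> w = 0) ->
  (forall k (y : 'I_k -> W),
     (forall j, exists c : 'I_n -> R, y j = \sum_i c i *: x i) ->
     (forall i, exists c : 'I_k -> R, x i = \sum_j c j *: y j) -> (n <= k)%N) ->
  forall c, \sum_i c i *: x i = 0 -> forall i, c i = 0.
Proof.
move=> mI unit_notin split_all W0 min c cx i.
pose f (v : 'rV[R]_n) : W := \sum_i v 0 i *: x i.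
have f_lin : linear f.
  move=> a u v; rewrite /f scaler_sumr -big_split /=; apply: eq_bigr => j _.
  by rewrite !mxE scalerDl scalerA.
pose fL : {linear 'rV[R]_n -> W} :=
  HB.pack f (GRing.isLinear.Build R 'rV[R]_n W *:%R f f_lin).
have f_delta j : fL (delta_mx 0 j) = x j.
  rewrite /= /f (bigD1 j) //= mxE !eqxx scale1r big1 ?addr0 // => k /negPf kj.
  by rewrite mxE eqxx kj scale0r.
pose z : 'rV[R]_n := \row_j c j.
have fz : fL z = 0.
  by rewrite -cx /= /f; apply: eq_bigr => j _; rewrite mxE.
pose L : {pred 'rV[R]_n} := fun v => `[< exists2 a, a \in m & v = a *: z >].
have L_closed : GRing.submod_closed L.
  split=> [|a _ _ /asboolP[b bm ->] /asboolP[d dm ->]]; apply/asboolP.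
    by exists 0; rewrite ?scale0r ?(ideal0 mI).
  by exists (a * b + d); rewrite ?(idealMD mI) // scalerDl scalerA.
pose N : submodClosed 'rV[R]_n :=
  HB.pack L (GRing.isSubmodClosed.Build R 'rV[R]_n L L_closed).
have [p [p_surj p_ker]] := lmod_quot_proj N.
have gens : spans (fun j => p (delta_mx 0 j)) predT.
  move=> v _; have [u <-] := p_surj v; exists (fun j => u 0 j).
  by rewrite -linear_sumZ -row_sum_delta.
have fgM : finitely_generated (lmod_quot N).
  by have [||s [_]] := spans_generates _ _ gens; last exists s.
have tors := torsion_eq0 mI unit_notin (split_all _ fgM) gens.
have pz0 : p z = 0.
  apply: tors => [k y yM|]; last first.
    (* The first power of [m] already kills [p z], since [m z] is divided out. *)
    apply/asboolP; exists 1%N => a /(ideal_pow1 mI) am.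
    by rewrite -linearZ; apply/p_ker/asboolP; exists a.
  have [q [q_surj q_ker]] := lmod_quot_proj (torsion m (M := lmod_quot N)).
  have /choice[w Ew] j : exists w, q (p w) = y j.
    by have [v <-] := q_surj (y j); have [w <-] := p_surj v; exists w.
  apply: (min _ (fun j => fL (w j))) => [j|j]; first by exists (fun l => w j 0 l).
  have [d Ed] := yM (q (p (delta_mx 0 j))) isT.
  exists d; apply/eqP; rewrite -f_delta -linear_sumZ -subr_eq0 -linearB.
  apply/eqP/W0.
  (* Some power of [m] carries the difference into [m z], which [fL] kills; its image is therefore
     torsion in [W], hence zero. *)
  have /q_ker/asboolP[e Ee] : q (p (delta_mx 0 j - \sum_l d l *: w l)) = 0.
    rewrite !linearB (linear_sumZ p) (linear_sumZ q) Ed.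
    apply/eqP; rewrite subr_eq0; apply/eqP.
    by apply: eq_bigr => l _; rewrite Ew.
  apply/asboolP; exists e => a /Ee; rewrite -(linearZ_LR p) -(linearZ_LR fL).
  by move=> /p_ker/asboolP[b _ ->]; rewrite linearZ_LR fz scaler0.
(* Now [z = a z] with [a] in [m], and [1 - a] is a unit. *)
have /asboolP[a am Ez] := (p_ker z).1 pz0.
have [b Eb] := unit_1sub mI unit_notin am.
have: z = 0.
  rewrite -[z]scale1r -Eb -scalerA scalerBl scale1r {1}Ez subrr.
  by rewrite scaler0.
by move=> /rowP/(_ i); rewrite !mxE.
Qed.

Lemma split_torsion_regular (R : comNzRingType) (m : {pred R}) :
  noetherian R -> maximal_ideal m ->
  (forall a, a \notin m -> exists b, b * a = 1) -> krull_dim R 1 ->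
  (forall M : lmodType R, finitely_generated M ->
      lmod_isomorphic (torsion_part m M * torsion_quot m M)%type M) ->
  regular_local m.
Proof.
move=> noeth mM unit_notin dim1 split_all.
have mI : idealr_closed m by case: mM.
have not_nil := krull_dim1_not_nil mM dim1.
have m_sub : @GRing.submod_closed R R^o m.
  by split=> [|a u v]; [exact: ideal0 | exact: idealMD].
have spansR : @spans R R^o 1 (fun=> 1) predT.
  by move=> v _; exists (fun=> v); rewrite big_ord1 /GRing.scale /= mulr1.
have R_tf : forall v : R^o, v \in torsion m (M := R^o) -> v = 0.
  have fgR : finitely_generated R^o.
    by have [||s [_]] := spans_generates _ _ spansR; last exists s.
  apply: (torsion_eq0 mI unit_notin (split_all _ fgR) spansR) => -[|//] y yN.
  (* Only [k = 0] remains: the quotient would vanish, so a power of [m] would kill [1] and [m] would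
     be nil. *)
  have [q [_ q_ker]] := lmod_quot_proj (torsion m (M := R^o)).
  have /q_ker/asboolP[e Ee] : q 1 = 0.
    by have [d ->] := yN (q 1) isT; rewrite big_ord0.
  case: not_nil => x xm; exists e.
  by have := Ee _ (expr_ideal_pow e xm); rewrite /GRing.scale /= mulr1.
have [n [[x [xm xs]] min]] : exists n,
    (exists x : 'I_n -> R^o, (forall i, x i \in m) /\ spans x m) /\
    forall k, (exists x : 'I_k -> R^o, (forall i, x i \in m) /\ spans x m) ->
      (n <= k)%N.
  apply: ex_least; have [s /generates_spans[sm ss]] := noeth _ m_sub.
  by exists (size s), (tnth (in_tuple s)); split=> // i; apply/sm/mem_tnth.
have comb_m k (y : 'I_k -> R^o) (c : 'I_k -> R) :
    (forall i, y i \in m) -> \sum_i c i *: y i \in m.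
  move=> ym; elim/big_ind: _ => [|u v|i _]; first exact: ideal0.
    exact: idealD.
  exact: idealM.
have x_free c : \sum_i c i *: x i = 0 -> forall i, c i = 0.
  apply: (min_spans_free mI unit_notin split_all R_tf) => k y yx xy.
  apply: min; exists y; split; last exact: spans_trans xs xy.
  by move=> j; have [d ->] := yx j; exact: comb_m.
have m_neq0 : ~ forall v, v \in m -> v = 0.
  by move=> m0; apply: not_nil => v vm; exists 1%N; rewrite (m0 v).
exists 1%N; split=> //; split=> [|s sm]; last first.
  rewrite lt0n size_eq0; apply/eqP => s0; rewrite {}s0 in sm.
  apply: m_neq0 => v vm.
  have [_ ss] := generates_spans sm; have [c ->] := ss v vm.
  by rewrite big_ord0.
have n1 : n = 1%N.
  case: n => [|[//|n]] in x xm xs min x_free *.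
    by case: m_neq0 => v /xs[c ->]; rewrite big_ord0.
  have x1 : x ord_max = 0.
    have neq : ord_max != ord0 :> 'I_n.+2 by [].
    (* The Koszul relation between the first and last generators. *)
    pose c (i : 'I_n.+2) : R :=
      if i == ord0 then x ord_max else if i == ord_max then - x ord0 else 0.
    apply: (x_free c _ ord0).
    rewrite (bigD1 ord0) //= (bigD1 ord_max) //= big1 => [|i /andP[i0 i1]].
      rewrite /c /= eqxx addr0.
      by change (x ord_max * x ord0 + - x ord0 * x ord_max = 0 :> R); ring.
    by rewrite /c (negPf i0) (negPf i1) scale0r.
  (* A zero generator satisfies a relation with coefficient [1], against freeness. *)
  have /x_free/(_ ord_max) : \sum_i (if i == ord_max then 1 else 0) *: x i = 0.
    rewrite (bigD1 ord_max) //= x1 scaler0 add0r big1 // => i /negPf->.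
    by rewrite scale0r.
  by rewrite eqxx => /eqP; rewrite oner_eq0.
by subst n; exact: (spans_generates m_sub xm xs).
Qed.

(** * From regularity to splitting *)

(* Dividing a relation between minimal generators by the largest possible power
   of the uniformizer [t] leaves a relation with a unit coefficient. *)
Lemma principal_min_spans_free (R : comNzRingType) (m : {pred R})
    (W : lmodType R) t n (x : 'I_n -> W) :
  (forall a, a \notin m -> exists b, b * a = 1) -> adic_complete m ->
  t \in m -> (forall v, v \in m -> exists c, v = c * t) ->
  (forall w : W, t *: w = 0 -> w = 0) ->
  spans x predT ->
  (forall k (y : 'I_k -> W), spans y predT -> (n <= k)%N) ->
  forall c, \sum_i c i *: x i = 0 -> forall i, c i = 0.
Proof.
move=> unit_notin mC tm mt W_tf xW min c cx i.
have W_tfX k (w : W) : t ^+ k *: w = 0 -> w = 0.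
  elim: k => [|k IHk]; first by rewrite scale1r.
  by rewrite exprS -scalerA => /W_tf/IHk.
apply: contrapT => ci_neq0.
(* Separatedness provides a least power of [m] missing some coefficient; its exponent is some
   [k.+1], because the zeroth power is the whole ring. *)
have [[|k] [[j cj] least_k]] :
    exists k, (exists j, c j \notin ideal_pow m k) /\
      forall l, (exists j, c j \notin ideal_pow m l) -> (k <= l)%N.
  apply: ex_least; apply: contrapT => all_in; apply: ci_neq0.
  apply: (adic_separated mC) => k; apply: contraT => cik.
  by case: all_in; exists k, i.
  case/negP: cj; rewrite -[c j]mulr1.
  exact/ideal_powM/(expr_ideal_pow 0 tm).
have /choice[b Eb] l : exists b, c l = b * t ^+ k.
  apply: (ideal_pow_principal mt); apply: contraT => clk.
  by have := least_k k; rewrite ltnn => -> //; exists l.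
(* Were [b j] in [m], then [c j] would lie in the power [k.+1]. *)
have [d Ed] : exists d, d * b j = 1.
  apply: unit_notin; apply: contra cj => /mt[e Ee].
  rewrite Eb Ee -mulrA -exprS.
  exact/ideal_powM/(expr_ideal_pow k.+1 tm).
have rel : \sum_l b l *: x l = 0.
  apply: (W_tfX k); rewrite -[RHS]cx scaler_sumr; apply: eq_bigr => l _.
  by rewrite scalerA Eb mulrC.
have := min _ _ (spans_drop xW rel Ed).
by rewrite leqNgt ltn_predL (leq_ltn_trans _ (ltn_ord j)).
Qed.

(** The quotient by torsion has a basis; lifting it to [M] gives a section [sec] of the
    projection. *)
Lemma principal_split (R : comNzRingType) (m : {pred R}) t (M : lmodType R) :
  (forall a, a \notin m -> exists b, b * a = 1) -> adic_complete m ->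
  t \in m -> (forall v, v \in m -> exists c, v = c * t) ->
  finitely_generated M ->
  lmod_isomorphic (torsion_part m M * torsion_quot m M)%type M.
Proof.
move=> unit_notin mC tm mt [s /generates_spans[_ sM]].
have [q [q_surj q_ker]] := lmod_quot_proj (torsion m (M := M)).
(* If the [k]-th power of [m] kills [t *: v], the next power, whose elements are multiples of
   [t ^+ k.+1], kills [v]. *)
have Q_tf (w : torsion_quot m M) : t *: w = 0 -> w = 0.
  have [v <-] := q_surj w; rewrite -(linearZ_LR q) => /q_ker/asboolP[k Ek].
  apply/q_ker/asboolP; exists k.+1 => a /(ideal_pow_principal mt)[c ->].
  rewrite exprSr mulrA -scalerA Ek //.
  exact/ideal_powM/(expr_ideal_pow k tm).
have [n [[x xQ] min]] : exists n,
    (exists x : 'I_n -> torsion_quot m M, spans x predT) /\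
    forall k, (exists x : 'I_k -> torsion_quot m M, spans x predT) ->
      (n <= k)%N.
  apply: ex_least; exists (size s), (fun i => q (tnth (in_tuple s) i)) => w _.
  have [v <-] := q_surj w; have [c ->] := sM v isT.
  by exists c; rewrite (linear_sumZ q).
have x_free : forall c, \sum_i c i *: x i = 0 -> forall i, c i = 0.
  apply: (principal_min_spans_free unit_notin mC tm mt Q_tf xQ) => k y yQ.
  by apply: min; exists y.
(* Coordinates are merely chosen; their uniqueness is what makes [sec] linear. *)
have [coord coordE] := choice (fun w => xQ w isT).
have coord_uniq c w : w = \sum_i c i *: x i -> forall i, coord w i = c i.
  move=> Ew i; apply/eqP; rewrite -subr_eq0; apply/eqP.
  apply: (x_free (fun i => coord w i - c i)).
  rewrite (eq_bigr _ (fun i _ => scalerBl _ _ _)) sumrB.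
  by rewrite -coordE -Ew subrr.
have [y Ey] := choice (fun i => q_surj (x i)).
pose sec (w : torsion_quot m M) : M := \sum_i coord w i *: y i.
have sec_lin : linear sec.
  move=> a u v; rewrite /sec scaler_sumr -big_split /=; apply: eq_bigr => i _.
  rewrite scalerA -scalerDl; congr (_ *: _).
  apply: (coord_uniq (fun i => a * coord u i + coord v i)).
  rewrite {1}(coordE u) {1}(coordE v) scaler_sumr -big_split /=.
  by apply: eq_bigr => j _; rewrite scalerDl scalerA.
have q_sec w : q (sec w) = w.
  rewrite (linear_sumZ q) {2}(coordE w).
  by apply: eq_bigr => i _; rewrite Ey.
have q_tors (u : torsion_part m M) : q (val u) = 0 by apply/q_ker/(valP u).
pose f (u : (torsion_part m M * torsion_quot m M)%type) : M :=
  val u.1 + sec u.2.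
have f_lin : linear f.
  by move=> a u v; rewrite /f /= sec_lin scalerDr addrACA; congr (_ + _).
have rest_tors v : v - sec (q v) \in torsion m (M := M).
  by apply/q_ker; rewrite linearB q_sec subrr.
pose fL : {linear (torsion_part m M * torsion_quot m M)%type -> M} :=
  HB.pack f (GRing.isLinear.Build R
    (torsion_part m M * torsion_quot m M)%type M *:%R f f_lin).
exists fL.
exists (fun v => (Sub (v - sec (q v)) (rest_tors v), q v)) => [[u w]|v] /=.
  have q_f : q (f (u, w)) = w by rewrite linearD q_tors q_sec add0r.
  congr pair; last exact: q_f.
  by apply: val_inj; rewrite SubK q_f /f /= addrK.
by rewrite /f /= subrK.
Qed.

Theorem proposition9p5 (R : comNzRingType) (m : {pred R}) :
  noetherian R -> local_ring m -> adic_complete m -> krull_dim R 1 ->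
  ((forall M : lmodType R, finitely_generated M ->
      lmod_isomorphic (torsion_part m M * torsion_quot m M)%type M)
   <-> regular_local m).
Proof.
move=> noeth [mM _] mC dim1.
have unit_notin := maximal_unit mM (fun a => adic_complete_unit mC (a := a)).
split=> [|[d [dimd [[s [size_s sm]] _]]] M Mfg].
  exact: split_torsion_regular.
(* Each of the two dimension bounds applies to the chain attaining the other. *)
have d1 : d = 1%N.
  have [[P Pc] le1] := dim1; have [[P' Pc'] led] := dimd.
  by apply/eqP; rewrite eqn_leq (le1 _ _ Pc') (led _ _ Pc).
have [s_sub s_spans] := generates_spans sm.
rewrite d1 in size_s; case: s size_s sm s_sub s_spans => [//|t [|//]] _ _ tm mt.
apply: (@principal_split R m t M unit_notin mC _ _ Mfg) => [|v /mt[c ->]].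
  exact/tm/mem_head.
by exists (c ord0); rewrite big_ord1.
Qed.
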